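(* Let $a>1$ be an integer with $t(a)=t(1)=1$. Then either $a=2$ (and the sequence is $(x_n^{(2)})$), or the sequence $(x_n^{(a)})$ essentially coincides with $(x_n^{(4)})$, i.e. there is $n_0$ such that $x_n^{(a)}=x_n^{(4)}$ for all $n\ge n_0$.
   Context: For a nonnegative integer $m$, $t(m)\in\{0,1\}$ is the parity of the number of ones in the binary expansion of $m$ (Thue–Morse sequence). For an integer $a>1$ with $t(a)=t(1)$, define $x_1^{(a)}=a$ and, for $n\ge2$, $x_n^{(a)}$ is the smallest integer $y>x_{n-1}^{(a)}$ with $t(y)=t(n)$. (E.g. $x^{(4)}$ begins $4,7,9,11,12,15,16,\dots$ and $x^{(2)}$ begins $2,4,5,7,9,\dots$.) *)

(* Defs.v *)
From mathcomp Require Import all_boot.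

Set Implicit Arguments.
Unset Strict Implicit.
Unset Printing Implicit Defensive.

(* The binary digit of [m] of weight [2 ^ i] is [odd (m %/ 2 ^ i)]; since
   [m < 2 ^ m], the digits of index at least [m] are all zero. *)
Definition num_ones (m : nat) : nat := \sum_(i < m) odd (m %/ 2 ^ i).

Definition t (m : nat) : nat := num_ones m %% 2.

Lemma num_ones_widen m N : m < 2 ^ N ->
  \sum_(i < N) odd (m %/ 2 ^ i) = num_ones m.
Proof.
have widen p q : p <= q -> m < 2 ^ p ->
    \sum_(i < q) odd (m %/ 2 ^ i) = \sum_(i < p) odd (m %/ 2 ^ i) :> nat.
  move=> le_pq lt_m.
  rewrite -!(big_mkord xpredT (fun i => nat_of_bool (odd (m %/ 2 ^ i)))).
  rewrite (@big_cat_nat _ _ _ p) //= [X in _ + X]big_nat_cond [X in _ + X]big1 ?addn0 //.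
  move=> i /andP[/andP[le_pi _] _]; rewrite divn_small //.
  by apply: leq_trans lt_m _; rewrite leq_exp2l.
move=> lt_m; case: (leqP m N) => [le_mN | /ltnW le_Nm].
  exact: (widen _ _ le_mN (ltn_expl m (ltnSn 1))).
exact: (esym (widen _ _ le_Nm lt_m)).
Qed.

Lemma num_ones_rec m : num_ones m = odd m + num_ones m./2.
Proof.
have lt1 : m < 2 ^ m.+1 := ltnW (ltn_expl m.+1 (ltnSn 1)).
have lt2 : m./2 < 2 ^ m.
  apply: leq_ltn_trans (ltn_expl m (ltnSn 1)).
  by rewrite leq_half_double -addnn leqW ?leq_addr.
rewrite -(num_ones_widen lt1) -(num_ones_widen lt2) big_ord_recl expn0 divn1.
by congr (_ + _); apply: eq_bigr => i _; rewrite expnS divnMA divn2.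
Qed.

Lemma exists_gt_t (n y : nat) : exists z, (y < z) && (t z == t n).
Proof.
have lt_y : y < y.+1.*2 by rewrite -addnn ltn_addl.
have t0 : t y.+1.*2 = t y.+1 by rewrite /t num_ones_rec odd_double doubleK.
have t1 : t y.+1.*2.+1 = (t y.+1).+1 %% 2.
  rewrite /t num_ones_rec oddS odd_double (half_bit_double _ true) /=.
  by rewrite -[in RHS]addn1 modnDml addnC.
have lt2 k : t k < 2 by rewrite ltn_mod.
have [e | ne] := eqVneq (t y.+1) (t n).
  by exists y.+1.*2; rewrite lt_y t0 e eqxx.
exists y.+1.*2.+1; rewrite ltnW //= t1.
by move: (lt2 y.+1) (lt2 n) ne; case: (t _) => [|[|]] //; case: (t _) => [|[|]].
Qed.

(* [xseq a n] is x_n^(a) for [n >= 1]; the value [xseq a 0 = a] is junk. *)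
Fixpoint xseq (a n : nat) : nat :=
  match n with
  | 0 | 1 => a
  | n'.+1 => ex_minn (exists_gt_t n (xseq a n'))
  end.

(* Main.v *)
Require Import Defs.
From mathcomp Require Import all_boot zify.

(** Since [t (2p) <> t (2p+1)], the term [x_n] is determined by [n] and by
    [p = x_n./2].  From [n] to [n+1], [p] increases by one, unless
    [t p = t n <> t (n+1)], in which case it does not move.  Hence the gap
    [c = p - n] never increases, and [c = 1] is stationary because
    [t (n+1) = t n <> t (n+1)] is absurd.  For every [c >= 2] there are
    arbitrarily large [n] with [t (n+c) = t n <> t (n+1)], so a gap that starts
    at [1] or above ends up equal to [1], which is the gap of [x^(4)] throughout.
    It starts below [1] only for [a = 2], as [t 3 = 0]. *)

Definition thue_morse (m : nat) : bool := odd (num_ones m).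

Lemma t_thue_morse m : t m = thue_morse m.
Proof. by rewrite /t modn2. Qed.

Lemma eq_t m n : (t m == t n) = (thue_morse m == thue_morse n).
Proof. by rewrite !t_thue_morse; do 2 case: (thue_morse _). Qed.

Lemma thue_morse_rec m : thue_morse m = odd m (+) thue_morse m./2.
Proof. by rewrite /thue_morse num_ones_rec oddD oddb. Qed.

Lemma thue_morse0 : thue_morse 0 = false.
Proof. by rewrite /thue_morse /num_ones big_ord0. Qed.

Lemma thue_morse_double m : thue_morse m.*2 = thue_morse m.
Proof. by rewrite thue_morse_rec odd_double doubleK. Qed.

Lemma thue_morse_doubleS m : thue_morse m.*2.+1 = ~~ thue_morse m.
Proof.
by rewrite thue_morse_rec oddS odd_double (half_bit_double _ true).
Qed.

(** The binary expansion of [2 ^ L * j + r] is that of [j] followed by that of [r], padded with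
    zeros to [L] digits. *)
Lemma thue_morse_concat L j r :
  r < 2 ^ L -> thue_morse (2 ^ L * j + r) = thue_morse j (+) thue_morse r.
Proof.
elim: L r => [|L IH] r.
  by case: r => // _; rewrite mul1n addn0 thue_morse0 addbF.
rewrite expnS -mulnA !mul2n -{1 2}(odd_double_half r) => lt_r.
rewrite addnCA -doubleD thue_morse_rec.
rewrite oddD odd_double addbF oddb half_bit_double IH; last by lia.
by rewrite (thue_morse_rec r) addbCA.
Qed.

(** For [m = 2 ^ k * j + (2 ^ k - k)], adding [k] clears the low [k] digits and carries into [j], so
    only the change from [j] to [j.+1] remains to be prescribed. *)
Lemma thue_morse_shift k (b : bool) N : 0 < k ->
  exists2 m, N <= m & thue_morse (m + k) = b (+) thue_morse m.
Proof.
move=> k_gt0; have lt_k : k < 2 ^ k := ltn_expl k (ltnSn 1).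
have lt_r : 2 ^ k - k < 2 ^ k by lia.
have shift j : let m := 2 ^ k * j + (2 ^ k - k) in
    thue_morse j.+1 = b (+) (thue_morse j (+) thue_morse (2 ^ k - k)) ->
    thue_morse (m + k) = b (+) thue_morse m.
  move=> m tj; rewrite (thue_morse_concat _ _ _ lt_r) -tj /m.
  have -> : 2 ^ k * j + (2 ^ k - k) + k = 2 ^ k * j.+1 + 0 by lia.
  by rewrite thue_morse_concat ?thue_morse0 ?addbF //; lia.
have le_N j : N <= j -> N <= 2 ^ k * j + (2 ^ k - k) by nia.
(* Between [j] and [j+1] the sequence changes if [j = 4N] and does not change
   if [j = 4N+1]. *)
case e: (b (+) thue_morse (2 ^ k - k)).
  exists (2 ^ k * N.*2.*2 + (2 ^ k - k)); first by apply: le_N; lia.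
  by apply: shift; rewrite addbCA e thue_morse_doubleS !thue_morse_double addbT.
exists (2 ^ k * N.*2.*2.+1 + (2 ^ k - k)); first by apply: le_N; lia.
apply: shift; rewrite addbCA e addbF -doubleS thue_morse_double.
by rewrite !thue_morse_doubleS thue_morse_double.
Qed.

(** An even [n = m.*2] gives the second condition for free and turns the first into a shift of [m]
    by [c./2], with a change of value exactly when [c] is odd. *)
Lemma thue_morse_gap c N : 1 < c ->
  exists2 n, N <= n &
    thue_morse (n + c) = thue_morse n /\ thue_morse n.+1 = ~~ thue_morse n.
Proof.
move=> c_gt1; have c2_gt0 : 0 < c./2 by lia.
have [m le_Nm tm] := thue_morse_shift c./2 (odd c) N c2_gt0.
exists m.*2; first by lia.
rewrite thue_morse_doubleS !thue_morse_double; split=> //.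
rewrite -{1}(odd_double_half c) addnCA -doubleD thue_morse_rec.
by rewrite oddD odd_double addbF oddb half_bit_double tm addbA addbb.
Qed.

Lemma thue_morse_halfK m :
  m = (thue_morse m (+) thue_morse m./2) + m./2.*2.
Proof. by rewrite (thue_morse_rec m) -addbA addbb addbF odd_double_half. Qed.

Lemma thue_morse_xseq a n :
  t a = t 1 -> 0 < n -> thue_morse (xseq a n) = thue_morse n.
Proof.
move=> ta; case: n => [//|[_|n _]]; first by apply/eqP; rewrite -eq_t ta.
by rewrite /=; case: ex_minnP => z /andP[_]; rewrite eq_t => /eqP.
Qed.

Lemma xseqE a n : t a = t 1 -> 0 < n ->
  let p := (xseq a n)./2 in xseq a n = (thue_morse n (+) thue_morse p) + p.*2.
Proof.
by move=> ta n_gt0 /=; rewrite {1}[xseq a n]thue_morse_halfK thue_morse_xseq.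
Qed.

Lemma xseqS a n z : 0 < n ->
    xseq a n < z -> thue_morse z = thue_morse n.+1 ->
    (forall w, xseq a n < w -> thue_morse w = thue_morse n.+1 -> z <= w) ->
  xseq a n.+1 = z.
Proof.
case: n => // n _ lt_z tz z_min /=.
case: ex_minnP => w /andP[lt_w]; rewrite eq_t => /eqP tw w_min.
apply/eqP; rewrite eqn_leq z_min // andbT.
by apply: w_min; rewrite lt_z eq_t tz eqxx.
Qed.

(** Each pair [2q, 2q+1] contains both values of [thue_morse], so the next term lies in the pair of
    [xseq a n] or in the following one. *)
Lemma half_xseqS a n : t a = t 1 -> 0 < n ->
  let p := (xseq a n)./2 in
  (xseq a n.+1)./2 =
    if (thue_morse p == thue_morse n) && (thue_morse n.+1 != thue_morse n)
    then p else p.+1.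
Proof.
move=> ta n_gt0; have := xseqE a n ta n_gt0; cbv zeta.
set p := _./2 => xE.
have tp0 := thue_morse_double p; have tp1 := thue_morse_doubleS p.
case: ifP => [/andP[/eqP tp tn] | moves].
  rewrite tp addbb in xE.
  rewrite (xseqS a n p.*2.+1) //; first by lia.
  - by rewrite xE; lia.
  - by rewrite tp1 tp; move: tn; do 2 case: (thue_morse _).
  - by rewrite xE => w; lia.
(* The candidate is the element of the pair [2p+2, 2p+3] with the required value. *)
rewrite (xseqS a n ((thue_morse n.+1 (+) thue_morse p.+1) + p.+1.*2)) //.
- by case: (_ (+) _); lia.
- by rewrite xE; case: (_ (+) _); lia.
- case e: (_ (+) _).
    rewrite add1n thue_morse_doubleS; move: e.
    by do 2 case: (thue_morse _).
  rewrite add0n thue_morse_double; move: e.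
  by do 2 case: (thue_morse _).
move=> w; rewrite xE => lt_w tw.
have [w_small | w_large] := leqP w p.*2.+1.
  (* Here [w = 2p+1] and [x_n = 2p]: this is the case excluded by [moves]. *)
  have x_even : thue_morse n (+) thue_morse p = false.
    by move: lt_w; case: (_ (+) _) => //; lia.
  have wE : w = p.*2.+1 by move: lt_w; rewrite x_even; lia.
  move: moves tw x_even; rewrite wE tp1.
  by case: (thue_morse p); case: (thue_morse n); case: (thue_morse n.+1).
(* If the candidate is [2p+3], then [2p+2] has the wrong value. *)
case e: (_ (+) _); last by lia.
have [wE|] := eqVneq w p.+1.*2; last by lia.
by move: tw e; rewrite wE thue_morse_double => ->; rewrite addbb.
Qed.

Lemma half_xseq_gap1 a n0 : t a = t 1 -> 0 < n0 -> (xseq a n0)./2 = n0.+1 ->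
  forall n, n0 <= n -> (xseq a n)./2 = n.+1.
Proof.
move=> ta n0_gt0 gap1 n /subnK <-; elim: (n - n0) => // k IH.
rewrite addSn half_xseqS ?IH //; last by lia.
by case: ifP => // /andP[/eqP ->]; rewrite eqxx.
Qed.

Lemma half_xseq_gap_decr a n0 c : t a = t 1 -> 0 < n0 -> 1 < c ->
    (xseq a n0)./2 = n0 + c ->
  exists2 n, 0 < n & (xseq a n)./2 = n + c.-1.
Proof.
move=> ta n0_gt0 c_gt1 gap.
have [n /subnK <- [tc tS]] := thue_morse_gap c n0 c_gt1.
move: (n - n0) tc tS => k tc tS.
(* Either the gap has dropped by index [k + n0], or it is still [c] there, where [tc] and [tS] force
   the drop at the next step. *)
have [//|gap_k] : (exists2 i, 0 < i & (xseq a i)./2 = i + c.-1) \/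
    (xseq a (k + n0))./2 = k + n0 + c.
  elim: k {tc tS} => [|k [IH|IH]]; [by right | by left |].
  have kn0_gt0 : 0 < k + n0 by lia.
  have := half_xseqS a (k + n0) ta kn0_gt0; cbv zeta; rewrite IH.
  case: ifP => _ step; [left; exists (k + n0).+1 => // | right];
    by rewrite ?addSn step; lia.
have kn0_gt0 : 0 < k + n0 by lia.
exists (k + n0).+1 => //; rewrite half_xseqS // gap_k tc tS eqxx.
by case: (thue_morse _) => /=; lia.
Qed.

Lemma half_xseq_gap1_reached a n0 c : t a = t 1 -> 0 < n0 ->
    (xseq a n0)./2 = n0 + c.+1 ->
  exists2 n, 0 < n & (xseq a n)./2 = n.+1.
Proof.
move=> ta; elim: c n0 => [|c IH] n0 n0_gt0 gap.
  by exists n0; rewrite ?gap ?addn1.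
have [n n_gt0 gap_n] := half_xseq_gap_decr a n0 c.+2 ta n0_gt0 isT gap.
exact: IH gap_n.
Qed.

Theorem theorem3 (a : nat) (a_gt1 : 1 < a) (ta : t a = t 1) :
  a = 2 \/ exists n0 : nat, forall n : nat, n0 <= n -> xseq a n = xseq 4 n.
Proof.
have t4 : t 4 = t 1.
  by rewrite !t_thue_morse (thue_morse_double 2) (thue_morse_double 1).
have [->|a_neq2] := eqVneq a 2; [by left | right].
have a_neq3 : a != 3.
  apply: contra_eq_neq ta => ->; rewrite eq_t.
  by rewrite (thue_morse_doubleS 1); case: (thue_morse 1).
(* Now [a >= 4], so the subtraction is not truncated and the initial gap is [a./2 - 1 >= 1]. *)
have [|n0 n0_gt0 gap1] := half_xseq_gap1_reached a 1 (a./2 - 2) ta isT.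
  by rewrite /=; lia.
exists n0 => n le_n; have n_gt0 : 0 < n by lia.
rewrite (xseqE a n ta n_gt0) (xseqE 4 n t4 n_gt0).
by rewrite (half_xseq_gap1 a n0) // (half_xseq_gap1 4 1).
Qed.
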